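(* Let $n,k$ be positive integers with $k\le n$. (a) If $n\le2$, then $\mathfrak r_{\triangle_{n,k}}$ is $p$-positive. (b) If $n\ge3$ is odd, then $\mathfrak r_{\triangle_{n,k}}$ is $p$-positive if and only if $k\in\{1,3,n-2,n\}$. (c) If $n\ge4$ is even, then $\mathfrak r_{\triangle_{n,k}}$ is $p$-positive if and only if $k\in\{1,3,n/2,n/2+1,n-2,n\}$.
   Context: Boxes $(r,c)$ are indexed by row $r$ (top to bottom) and column $c$. A connected ribbon of composition $\alpha=(\alpha_1,\dots,\alpha_\ell)$ has $\alpha_r$ consecutive boxes in row $r$, with the leftmost box of row $r$ directly above the rightmost box of row $r+1$. For a ribbon $D$, $\mathfrak r_D=\sum_T x^{c(T)}$ over fillings $T$ of $D$ with letters of $\{1'<1<2'<2<\cdots\}$ having rows and columns weakly increasing, at most one unmarked $k$ per column and at most one marked $k'$ per row; $c(T)_i$ counts entries $i$ or $i'$. $\triangle_{n,k}$ ($1\le k\le n$) is the ribbon of composition $(1^{k-1},n-k+1)$. A symmetric function is $p$-positive if all its coefficients in the power sum basis $\{p_\lambda\}$ are nonnegative. *)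

(* Defs.v *)
From HB Require Import structures.
From mathcomp Require Import all_boot all_order all_algebra.
Set Implicit Arguments. Unset Strict Implicit. Unset Printing Implicit Defensive.
Import Order.TTheory GRing.Theory Num.Theory.

(* Boxes of the connected ribbon of composition [al].  Rows are indexed from 0
   (top) and columns from 0; the bottom row starts in column 0.  The leftmost
   column of row i is  sum_{s > i} (al_s - 1), so that the leftmost box of
   row i sits directly above the rightmost box of row i+1. *)
Definition ribbon_boxes (al : seq nat) : seq (nat * nat) :=
  flatten [seq [seq (i, sumn (map predn (drop i.+1 al)) + j)
               | j <- iota 0 (nth 0 al i)]
          | i <- iota 0 (size al)].

Definition tri (n k : nat) : seq nat := rcons (nseq k.-1 1) (n - k + 1).

(* Letters {1' < 1 < 2' < 2 < ...} are encoded by nat codes: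
   i' |-> 2(i-1), i |-> 2(i-1)+1.  A code c is unmarked iff odd c, and its
   variable index (0-based) is c./2.  Fillings using letters of value <= N
   are finite functions from the boxes to 'I_(2N). *)
Definition filling (B : seq (nat * nat)) (N : nat) :=
  {ffun 'I_(size B) -> 'I_(2 * N)}.

Definition valid_filling (B : seq (nat * nat)) (N : nat) (T : filling B N)
  : bool :=
  [forall i : 'I_(size B), forall j : 'I_(size B),
    let bi := nth (0, 0) B i in let bj := nth (0, 0) B j in
    [&& ((bi.1 == bj.1) && (bi.2 < bj.2)) ==> (T i <= T j),
        ((bi.2 == bj.2) && (bi.1 < bj.1)) ==> (T i <= T j),
        [&& i != j, bi.2 == bj.2 & val (T i) == val (T j)] ==> ~~ odd (T i)
      & [&& i != j, bi.1 == bj.1 & val (T i) == val (T j)] ==> odd (T i)]].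

Definition content (B : seq (nat * nat)) (N : nat) (T : filling B N)
  (j : 'I_N) : nat :=
  #|[set i : 'I_(size B) | (val (T i))./2 == val j]|.

(* Coefficient of x^a in r_D(x_1, ..., x_N). *)
Definition rcoef (B : seq (nat * nat)) (N : nat) (a : 'I_N -> nat) : nat :=
  #|[set T : filling B N |
      valid_filling T && [forall j, content T j == a j]]|.

(* Coefficient of x^a in p_la(x_1, ..., x_N). *)
Definition pcoef (la : seq nat) (N : nat) (a : 'I_N -> nat) : nat :=
  #|[set f : {ffun 'I_(size la) -> 'I_N} |
      [forall j, (\sum_(i | f i == j) nth 0 la i)%N == a j]]|.

Definition is_partition (n : nat) (la : seq nat) : bool :=
  [&& sorted geq la, all (fun x => 0 < x)%N la & sumn la == n].

(* r_D is p-positive: r_D = sum of nonnegative rational multiples of p_la,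
   |la| = |D| = N, tested in N variables (which determines a degree-N
   symmetric function, and in which the p_la, |la| = N, are independent). *)
Definition p_positive (al : seq nat) : Prop :=
  let B := ribbon_boxes al in
  let N := size B in
  exists s : seq (seq nat * rat),
    all (fun x => is_partition N x.1 && (0 <= x.2)%R) s /\
    forall a : 'I_N -> nat,
      ((rcoef B a)%:R = \sum_(x <- s) x.2 * (pcoef x.1 a)%:R)%R.

(* Main.v *)
Require Import Defs.
From mathcomp Require Import all_boot all_order all_algebra.
From mathcomp Require Import zify ring lra mpoly.
Set Implicit Arguments. Unset Strict Implicit. Unset Printing Implicit Defensive.
Import Order.TTheory GRing.Theory Num.Theory.

(** Write [q_n] for the function of a one-row (or one-column) shape.  Gluing a
    column of [j] boxes to a row of [n - j] boxes in the two possible ways gives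
    [r_(n,j+1) + r_(n,j) = q_j q_(n-j)].  Since
    [Q(t) = sum_n q_n t^n = exp (2 sum_(d odd) p_d t^d / d)], expanding
    [Q(t) Q(tu)] shows that the coefficient of [p_la] in [r_(n,k)] is zero unless
    all parts of [la] are odd, and is then a positive multiple of the coefficient
    of [u^(k-1)] in [prod_i (1 + u^la_i) / (1 + u)].  This polynomial is
    palindromic; its coefficients of [u^0] and [u^2] are nonnegative, and so are
    the two equal middle ones for [n] even, as half a coefficient of
    [prod_i (1 + u^la_i)].  With [j = k - 1] taken in the lower half by symmetry,
    a negative coefficient in the other cases comes from [la] equal to
    - [(n)] for [n] and [j] odd;
    - [(j-1, j-1, n-2j+2)] for [n] odd and [j] even;
    - [(j+2, n-j-2)] for [n] even and [j] odd;
    - [(j-1, j-1, 3, n-2j-1)] for [n] and [j] even. *)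

(** * Sums over words of fixed length *)

Section WordSums.
Local Open Scope ring_scope.
Variable R : comNzRingType.

(** Letters are naturals below [c] rather than elements of ['I_c], so that recurrences can change
    the alphabet without casts. *)
Fixpoint wsum (c n : nat) (F : seq nat -> R) : R :=
  if n is n'.+1 then \sum_(0 <= a < c) wsum c n' (fun w => F (a :: w))
  else F [::].

Lemma wsum_nil c F : wsum c 0 F = F [::].
Proof. by []. Qed.

Lemma wsumS c n F :
  wsum c n.+1 F = \sum_(0 <= a < c) wsum c n (fun w => F (a :: w)).
Proof. by []. Qed.

Lemma eq_wsum c n F G :
    (forall w, size w = n -> all (gtn c) w -> F w = G w) ->
  wsum c n F = wsum c n G.
Proof.
elim: n F G => [|n IH] F G eqFG /=; first exact: eqFG.
apply: eq_big_nat => a /andP[_ lt_a]; apply: IH => w sz_w w_c.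
by apply: eqFG; rewrite /= ?sz_w ?lt_a.
Qed.

Lemma wsum0 c n : wsum c n (fun=> 0) = 0.
Proof. by elim: n => //= n IH; rewrite big1. Qed.

Lemma wsumD c n F G :
  wsum c n (fun w => F w + G w) = wsum c n F + wsum c n G.
Proof.
elim: n F G => //= n IH F G; rewrite -big_split.
by apply: eq_bigr => a _; rewrite IH.
Qed.

Lemma wsum_sum c n k (F : nat -> seq nat -> R) :
  wsum c n (fun w => \sum_(0 <= a < k) F a w) = \sum_(0 <= a < k) wsum c n (F a).
Proof.
elim: n F => //= n IH F; rewrite exchange_big.
by apply: eq_bigr => b _; rewrite IH.
Qed.

Lemma wsumZl c n r F : wsum c n (fun w => r * F w) = r * wsum c n F.
Proof.
elim: n F => //= n IH F; rewrite big_distrr.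
by apply: eq_bigr => a _; rewrite IH.
Qed.

Lemma wsumZr c n r F : wsum c n (fun w => F w * r) = wsum c n F * r.
Proof. by rewrite mulrC -wsumZl; apply: eq_wsum => w _ _; rewrite mulrC. Qed.

Lemma wsum_rcons c n F :
  wsum c n.+1 F = \sum_(0 <= a < c) wsum c n (fun w => F (rcons w a)).
Proof.
elim: n F => // n IH F.
rewrite wsumS; under eq_bigr do rewrite IH.
by rewrite exchange_big.
Qed.

Lemma wsum_cat c m n F :
  wsum c (m + n) F = wsum c m (fun u => wsum c n (fun v => F (u ++ v))).
Proof.
elim: m F => //= m IH F.
by apply: eq_bigr => a _; rewrite IH.
Qed.

Lemma wsum_widen c n F :
  wsum c.+1 n (fun w => if all (gtn c) w then F w else 0) = wsum c n F.
Proof.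
elim: n F => //= n IH F.
rewrite big_nat_recr //= ltnn /= wsum0 addr0.
by apply: eq_big_nat => a /andP[_ lt_a]; rewrite lt_a /= IH.
Qed.

Lemma wsum_tuple c n F :
  wsum c n F = \sum_(t : n.-tuple 'I_c) F (map val t).
Proof.
elim: n F => [|n IH] F /=.
  rewrite (bigD1 [tuple]) //= big1 ?addr0 // => t /eqP[].
  exact: tuple0.
pose cns (p : 'I_c * n.-tuple 'I_c) := cons_tuple p.1 p.2.
rewrite (reindex cns) /=; last first.
  exists (fun t => (thead t, behead_tuple t)) => [[a t]|t] _.
    by rewrite /cns theadE; congr pair; apply: val_inj.
  by apply: val_inj; rewrite [t in RHS]tuple_eta.
rewrite -(pair_big predT predT (fun a (t : n.-tuple 'I_c) => F (val a :: map val t))) /=.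
by rewrite big_mkord; apply: eq_bigr => a _; rewrite IH.
Qed.

Lemma wsum_ffun c n F :
  wsum c n F = \sum_(T : {ffun 'I_n -> 'I_c}) F [seq val (T i) | i <- enum 'I_n].
Proof.
rewrite wsum_tuple (reindex (fun T : {ffun 'I_n -> 'I_c} => [tuple T i | i < n])) /=.
  by apply: eq_bigr => T _; rewrite -map_comp.
exists (fun t => [ffun i => tnth t i]) => [T|t] _.
  by apply/ffunP => i; rewrite ffunE tnth_mktuple.
by apply: eq_from_tnth => i; rewrite tnth_mktuple ffunE.
Qed.

(** * Generating functions of rows, columns and hooks *)

Arguments wsum : simpl never.

(* [step odd] is the condition between consecutive row entries and
   [step (predC odd)] the one between consecutive column entries. *)
Definition step (phi : pred nat) : rel nat :=
  fun a b => (a < b)%N || (a == b) && phi b.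

Lemma step_trans phi : transitive (step phi).
Proof.
move=> b a c /orP[ab|/andP[/eqP-> _]] // /orP[bc|/andP[/eqP<- pb]].
  by rewrite /step (ltn_trans ab bc).
by rewrite /step ab.
Qed.

(** This complementarity is what makes exactly one of the two gluings in [hookS] admissible. *)
Lemma stepN phi a b : step (predC phi) a b = ~~ step phi b a.
Proof.
by rewrite /step /=; case: (ltngtP a b) => //= ->.
Qed.

Lemma pairwise_step_rcons2 phi w a b :
  pairwise (step phi) (rcons (rcons w a) b) =
    pairwise (step phi) (rcons w a) && step phi a b.
Proof.
rewrite -!(sorted_pairwise (@step_trans phi)).
case: w => [|d w] /=; first by rewrite andbT.
by rewrite !rcons_path last_rcons.
Qed.

Variable x : nat -> R.

Definition wt (w : seq nat) : R := \prod_(a <- w) x a./2.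

Lemma wt_rcons w a : wt (rcons w a) = wt w * x a./2.
Proof. by rewrite /wt big_rcons /= mulrC. Qed.

Lemma wt_cat v w : wt (v ++ w) = wt v * wt w.
Proof. exact: big_cat. Qed.

Definition chains (phi : pred nat) (c n : nat) : R :=
  wsum c n (fun w => (pairwise (step phi) w)%:R * wt w).

Lemma chains0 phi c : chains phi c 0 = 1.
Proof. by rewrite /chains wsum_nil /wt big_nil mulr1. Qed.

Lemma chainsS0 phi n : chains phi 0 n.+1 = 0.
Proof. by rewrite /chains wsumS big_geq. Qed.

(* Split the words according to whether their last letter is the largest one. *)
Lemma chainsSS phi c n :
  chains phi c.+1 n.+1 =
    chains phi c n.+1 + x c./2 * chains phi (if phi c then c.+1 else c) n.
Proof.
rewrite {1}/chains wsum_rcons big_nat_recr //=; congr (_ + _).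
  rewrite /chains wsum_rcons; apply: eq_big_nat => a /andP[_ lt_a].
  rewrite -[RHS]wsum_widen; apply: eq_wsum => w _ _.
  case: ifPn => // w_c; rewrite pairwise_rcons.
  case: allP => [w_a|]; last by rewrite mul0r.
  case/negP: w_c; apply/allP => b /w_a /=; rewrite /step /=; lia.
rewrite /chains -wsumZl; case: ifPn => [pc|npc].
  apply: eq_wsum => w _ w_c; rewrite pairwise_rcons wt_rcons.
  have ->: all ((step phi)^~ c) w.
    by apply: sub_all w_c => b /=; rewrite /step pc andbT ltnS leq_eqVlt orbC.
  by rewrite /=; ring.
rewrite -[RHS]wsum_widen; apply: eq_wsum => w _ _; rewrite pairwise_rcons wt_rcons.
have -> : all ((step phi)^~ c) w = all (gtn c) w.
  by apply: eq_all => b /=; rewrite /step (negPf npc) andbF orbF.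
by case: ifP => _ /=; ring.
Qed.

(** Adjoining the two letters of [x c] multiplies the series in t by (1 + x_c t) / (1 - x_c t). *)
Lemma rows_rec c n :
  chains odd c.*2.+2 n.+1 =
    chains odd c.*2 n.+1 + x c * chains odd c.*2 n + x c * chains odd c.*2.+2 n.
Proof.
by rewrite !chainsSS /= odd_double /= uphalf_double doubleK.
Qed.

Lemma cols_rec c n :
  chains (predC odd) c.*2.+2 n.+1 =
    chains (predC odd) c.*2 n.+1 + x c * chains (predC odd) c.*2 n
    + x c * chains (predC odd) c.*2.+2 n.
Proof.
have rec1 m : chains (predC odd) c.*2.+2 m.+1 =
    chains (predC odd) c.*2.+1 m.+1 + x c * chains (predC odd) c.*2.+1 m.
  by rewrite chainsSS /= odd_double /= uphalf_double.
have rec2 m : chains (predC odd) c.*2.+1 m.+1 =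
    chains (predC odd) c.*2 m.+1 + x c * chains (predC odd) c.*2.+1 m.
  by rewrite chainsSS /= odd_double /= doubleK.
by rewrite rec1 rec2; case: n => [|n]; rewrite ?chains0 ?rec1 ?rec2; ring.
Qed.

Definition qrow N n := chains odd N.*2 n.

Lemma qrow0 N : qrow N 0 = 1. Proof. exact: chains0. Qed.
Lemma qrow0S n : qrow 0 n.+1 = 0. Proof. exact: chainsS0. Qed.
Lemma qrowSS N n :
  qrow N.+1 n.+1 = qrow N n.+1 + x N * qrow N n + x N * qrow N.+1 n.
Proof. exact: rows_rec. Qed.

(** Rows and columns obey the same recurrence with the same initial values. *)
Lemma qcolE N n : chains (predC odd) N.*2 n = qrow N n.
Proof.
elim: N n => [|N IHN] [|n]; rewrite ?qrow0 ?chains0 ?qrow0S ?chainsS0 //.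
by elim: n => [|n IHn]; rewrite qrowSS cols_rec !IHN ?IHn // chains0 !qrow0.
Qed.

(** A word lists the [j] boxes above the bottom row from top to bottom, then that row from left to
    right. Its last letter is the corner, which also ends the column. *)
Definition hookword (j : nat) (w : seq nat) : bool :=
  pairwise (step (predC odd)) (rcons (take j w) (last 0%N w))
  && pairwise (step odd) (drop j w).

Definition hook (N j m : nat) : R :=
  wsum N.*2 (j + m) (fun w => (hookword j w)%:R * wt w).

Lemma hookE N j m : hook N j m.+1 =
  wsum N.*2 j (fun u => wsum N.*2 m.+1 (fun v =>
    (pairwise (step (predC odd)) (rcons u (last 0%N v))
     && pairwise (step odd) v)%:R * (wt u * wt v))).
Proof.
rewrite /hook wsum_cat; apply: eq_wsum => u sz_u _; apply: eq_wsum => v sz_v _.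
rewrite /hookword -sz_u take_size_cat // drop_size_cat // wt_cat last_cat.
by case: v sz_v.
Qed.

Lemma hook0 N m : hook N 0 m.+1 = qrow N m.+1.
Proof.
rewrite hookE wsum_nil; apply: eq_wsum => v _ _ /=.
by rewrite /wt big_nil mul1r.
Qed.

(** Let [a] end a column and [z] end a row. Either [a] can be put above [z], lengthening the column
    of the hook, or to the right of [z], becoming its corner; by [stepN] never both. *)
Lemma hookS N j m :
  hook N j.+1 m.+1 + hook N j m.+2 = qrow N j.+1 * qrow N m.+1.
Proof.
rewrite -qcolE !hookE /chains -wsumZr.
under [X in _ + X]eq_wsum => u _ _ do rewrite wsum_rcons.
rewrite wsum_sum 2![wsum _ j.+1 _]wsum_rcons -big_split /=.
apply: eq_bigr => a _; rewrite -wsumD; apply: eq_wsum => u _ _.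
rewrite /qrow /chains -wsumD -wsumZl; apply: eq_wsum => v sz_v _.
case/lastP: v sz_v => // v z _.
rewrite !last_rcons !pairwise_step_rcons2 stepN !wt_rcons.
case: (pairwise (step odd) (rcons v z)); case: (pairwise _ (rcons u a)).
all: by case: (step odd z a) => /=; ring.
Qed.
End WordSums.

(** * A Newton recurrence for the one-row functions *)

Section Newton.
Local Open Scope ring_scope.
Variables (R : comNzRingType) (x : nat -> R).

Definition psum N d : R := \sum_(0 <= i < N) x i ^+ d.

Definition oddconv (f g : nat -> R) n : R :=
  \sum_(0 <= d < n.+1) (if odd d then 2 * f d * g (n - d)%N else 0).

(** The term d = 1 is split off and the others shift by two, which keeps parity: the kernel is 2yt /
    (1 - y^2 t^2). *)
Lemma oddconv_geom y g n :
  oddconv (GRing.exp y) g n.+2 = 2 * y * g n.+1 + y ^+ 2 * oddconv (GRing.exp y) g n.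
Proof.
rewrite /oddconv 2?big_nat_recl //= add0r expr1 subSS subn0 big_distrr /=.
congr (_ + _); apply: eq_bigr => d _; rewrite negbK !subSS.
by case: ifP => _; rewrite ?mulr0 // !exprS; ring.
Qed.

(* Coefficientwise form of t Q' / Q = 2 sum_(d odd) p_d t^d for the series
   Q = prod_i (1 + x_i t) / (1 - x_i t) of the one-row functions. *)
Lemma newton N n : n%:R * qrow x N n = oddconv (psum N) (qrow x N) n.
Proof.
elim: N n => [|N IHN] n.
  rewrite /oddconv big1 => [|d _]; last by rewrite /psum big_geq // mulr0 mul0r if_same.
  by case: n => [|n]; rewrite ?mul0r ?qrow0S ?mulr0.
pose q := qrow x N; pose q' := qrow x N.+1; pose y := x N.
have qS m : q' m.+1 = q m.+1 + y * q m + y * q' m by exact: qrowSS.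
(* [U] and [T] are the contributions of the new variable and of the old ones. Clearing the
   denominator in (1 - yt) q' = (1 + yt) q gives each a first-order recurrence. *)
pose U := oddconv (GRing.exp y) q'.
have U_S m : U m.+1 = y * U m + y * (q m + q' m).
  elim: m => [|m IHm].
    rewrite /U /oddconv !big_nat_recr //= !big_geq //= /q /q' !qrow0; ring.
  by rewrite {1}/U oddconv_geom -/(U m) IHm qS; ring.
pose T := oddconv (psum N) q'.
have T_S m : T m.+1 = oddconv (psum N) q m.+1 + y * oddconv (psum N) q m + y * T m.
  rewrite /T /oddconv [LHS]big_nat_recr //= [X in _ = X + _ + _]big_nat_recr //=.
  rewrite !subnn /q /q' !qrow0 [X in _ = X + _]addrAC [RHS]addrAC; congr (_ + _).
  rewrite !big_distrr -!big_split /=; apply: eq_big_nat => d /andP[_ le_d].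
  case: ifP => _; rewrite ?mulr0 ?addr0 // subSn // -/q -/q' qS; ring.
have -> : oddconv (psum N.+1) q' n = T n + U n.
  rewrite /T /U /oddconv -big_split; apply: eq_bigr => d _ /=.
  by case: ifP => _; rewrite ?addr0 // /psum big_nat_recr //=; ring.
elim: n => [|n IHn].
  by rewrite mul0r /T /U /oddconv !big_nat1 /= addr0.
rewrite T_S U_S -!IHN -/q -/q' qS.
have -> : y * T n = n%:R * y * q' n - y * U n by rewrite -mulrA mulrCA IHn; ring.
rewrite -[n.+1]addn1 natrD; ring.
Qed.

(** Leibniz rule for the degree derivation on a product; the guards put both sums on a common
    range. *)
Lemma newton2 N i m :
  (i + m)%:R * (qrow x N i * qrow x N m) =
  \sum_(0 <= d < (i + m).+1) (if odd d then 2 * psum N d *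
     ((if (d <= i)%N then qrow x N (i - d) * qrow x N m else 0)
    + (if (d <= m)%N then qrow x N i * qrow x N (m - d) else 0)) else 0).
Proof.
have ext f (k l : nat) : (k <= l)%N ->
    \sum_(0 <= d < k.+1) f d = \sum_(0 <= d < l.+1) (if (d <= k)%N then f d else 0) :> R.
  move=> le_kl; rewrite (@big_cat_nat _ _ _ k.+1 0 l.+1) //=.
  rewrite [X in _ = _ + X]big1_seq ?addr0.
    by apply: eq_big_nat => d /andP[_]; rewrite ltnS => ->.
  by move=> d; rewrite mem_index_iota => /andP[_ /andP[lt_d _]]; rewrite leqNgt lt_d.
transitivity (i%:R * qrow x N i * qrow x N m + m%:R * qrow x N m * qrow x N i).
  by rewrite natrD; ring.
rewrite !newton /oddconv (ext _ i (i + m)%N) ?leq_addr //.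
rewrite (ext _ m (i + m)%N) ?leq_addl //.
rewrite !big_distrl -big_split; apply: eq_bigr => d _ /=.
by case: ifP => _; case: ifP => _; case: ifP => _; ring.
Qed.
End Newton.

(** * The polynomials in u attached to a list of odd parts *)

Section Coefficients.
Local Open Scope ring_scope.

(* Coefficient of [u^j] in [prod_(d <- la) (1 + u^d)]. *)
Fixpoint cprod (la : seq nat) (j : nat) : rat :=
  if la is d :: la' then cprod la' j + (if (d <= j)%N then cprod la' (j - d) else 0)
  else (j == 0%N)%:R.

(* Coefficient of [u^j] in [prod_(d <- la) (1 + u^d) / (1 + u)]. *)
Fixpoint calt (la : seq nat) (j : nat) : rat :=
  if la is d :: la' then calt la' j + (if (d <= j)%N then calt la' (j - d) else 0)
  else (-1) ^+ j.

Lemma cprod_ge0 la j : 0 <= cprod la j.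
Proof.
elim: la j => [|d la IH] j /=; first exact: ler0n.
by apply: addr_ge0 => //; case: ifP.
Qed.

Lemma cprod_gt la j : (sumn la < j)%N -> cprod la j = 0.
Proof.
elim: la j => [|d la IH] j /=; first by case: j.
move=> lt_j; rewrite !IH ?if_same ?addr0 //; lia.
Qed.

Lemma calt0 la : all odd la -> calt la 0 = 1.
Proof.
by elim: la => //= d la IH /andP[od /IH->]; case: d od => //= d; rewrite addr0.
Qed.

Lemma cprod0 la : all odd la -> cprod la 0 = 1.
Proof.
by elim: la => //= d la IH /andP[od /IH->]; case: d od => //= d; rewrite addr0.
Qed.

Lemma cprodS la j : all odd la -> cprod la j.+1 = calt la j.+1 + calt la j.
Proof.
elim: la j => [|d la IH] j /=; first by move=> _; rewrite exprS; ring.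
case/andP=> od o_la; rewrite IH //; case: (ltngtP d j.+1) => [lt_d|gt_d|->].
- by rewrite -ltnS lt_d subSn // IH //; ring.
- by rewrite leqNgt (ltn_trans _ gt_d) //=; ring.
- by rewrite ltnn subnn cprod0 // calt0 //; ring.
Qed.

Lemma calt_swap d e la : calt [:: d, e & la] =1 calt [:: e, d & la].
Proof.
move=> j /=; case: (leqP d j) => dj; case: (leqP e j) => ej.
- rewrite [(j - e - d)%N]subnAC; have -> : (d <= j - e)%N = (e <= j - d)%N by lia.
  by ring.
- have -> : (e <= j - d)%N = false by lia.
  by ring.
- have -> : (d <= j - e)%N = false by lia.
  by ring.
- by [].
Qed.

(** Compositions with the same sorted form thus contribute to the same power sum with the same
    sign. *)
Lemma calt_perm la mu : perm_eq la mu -> calt la =1 calt mu.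
Proof.
have front d s t : calt (s ++ d :: t) =1 calt (d :: s ++ t).
  elim: s => // e s IHs j; rewrite [RHS](calt_swap d e).
  by rewrite /= !IHs.
elim: la mu => [|d la IH] mu; first by rewrite perm_sym => /perm_nilP->.
move=> eq_mu; have /splitPr def_mu : d \in mu by rewrite -(perm_mem eq_mu) mem_head.
case: def_mu eq_mu => s t; rewrite perm_sym (perm_catCA s [:: d] t) perm_cons => eq_la j.
have IHla : calt la =1 calt (s ++ t) by apply: IH; rewrite perm_sym.
by rewrite front /= !IHla.
Qed.

(** One odd part already makes 1 + u a divisor, so the quotient is a polynomial of degree
    [sumn la - 1]. *)
Lemma calt_ge la j : la != [::] -> all odd la -> (sumn la <= j)%N -> calt la j = 0.
Proof.
elim: la j => // d la IH j _ /= /andP[od o_la] le_j.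
case: la IH o_la le_j => [|e la] IH o_la le_j.
  rewrite /= in le_j *; have le_d: (d <= j)%N by lia.
  rewrite le_d -{1}(subnK le_d) exprD -(signr_odd _ d) od; ring.
have ? : (d <= j)%N by lia.
rewrite !IH ?if_same ?addr0 //=; move: le_j => /=; lia.
Qed.

Lemma calt_sym la i j :
  la != [::] -> all odd la -> (i + j).+1 = sumn la -> calt la i = calt la j.
Proof.
elim: la i j => // d la IH i j _ /andP[od o_la] def_n.
case: (altP (la =P [::])) => [la0 | nz_la].
  rewrite la0 /= in def_n *; rewrite !ifN; try by rewrite -ltnNge; lia.
  rewrite -signr_odd -[in RHS]signr_odd; congr (_ ^+ nat_of_bool _ + _).
  have := congr1 odd def_n; rewrite /= addn0 od oddD.
  by case: (odd i); case: (odd j).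
(* Reflection in the tail sends index k to l - d, so the two summands of [calt (d :: la)] are
   exchanged. *)
have half k l : (k + l).+1 = (d + sumn la)%N ->
    calt la k = if (d <= l)%N then calt la (l - d) else 0.
  move=> def_kl; case: ifP => le_d; first by apply: IH => //; lia.
  by rewrite calt_ge //; lia.
by rewrite /= [calt la i](half i j) // [in RHS](half j i) // 1?addrC // (addnC j).
Qed.

(** Modulo u^3 only parts equal to 1 matter, so these are binomial coefficients of (1 + u)^(c - 1),
    with c the number of such parts. *)
Lemma calt2 la : all odd la ->
  calt la 1 = (count_mem 1%N la)%:R - 1 /\
  2 * calt la 2 = ((count_mem 1%N la)%:R - 1) * ((count_mem 1%N la)%:R - 2).
Proof.
elim: la => [|d la IH] /=; first by split; ring.
case/andP=> od o_la; have [IH1 IH2] := IH o_la.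
case: d od => [|[|[|d]]] //= _; last by rewrite !addr0 add0n.
by rewrite calt0 // natrD mulrDr IH1 IH2; split; ring.
Qed.

Lemma calt2_ge0 la : all odd la -> 0 <= calt la 2.
Proof.
move=> /calt2[_]; case: (count_mem 1%N la) => [|[|n]] E.
- lra.
- by move: E; rewrite subrr mul0r; lra.
- have: 0 <= (n.+2%:R - 1) * (n.+2%:R - 2) :> rat.
    by rewrite -addn2 natrD; have := ler0n rat n; move=> ?; apply: mulr_ge0; lra.
  lra.
Qed.

(** The two middle coefficients agree by symmetry and add up to a coefficient of [cprod]. *)
Lemma calt_mid_ge0 la h :
  la != [::] -> all odd la -> sumn la = h.+1.*2 -> 0 <= calt la h.
Proof.
move=> nz_la o_la def_h.
have := cprod_ge0 la h.+1; rewrite cprodS // (@calt_sym la h.+1 h) //; first lra.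
by rewrite def_h; lia.
Qed.

(* The weights [prod_i 2 / (d_i + ... + d_l)] of the compositions
   [(d_1, ..., d_l)] come from iterating [newton]; summing over compositions
   instead of partitions avoids the centralizer orders [z_la]. *)
Fixpoint oddcomps (fuel n : nat) : seq (seq nat * rat) :=
  if n == 0%N then [:: ([::], 1)] else
  if fuel is fuel'.+1 then
    flatten [seq [seq (d :: x.1, 2 / n%:R * x.2) | x <- oddcomps fuel' (n - d)]
            | d <- iota 1 n & odd d]
  else [::].

Lemma oddcompsP fuel n x : x \in oddcomps fuel n ->
  [/\ all odd x.1, sumn x.1 = n & 0 < x.2].
Proof.
elim: fuel n x => [|f IH] n x /=; case: eqP => [-> | /eqP nz_n] //.
1,2: by rewrite inE => /eqP->.
case/flatten_mapP=> d; rewrite mem_filter mem_iota => /and3P[od _ le_d].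
case/mapP=> y /IH[o_y def_y y_gt0] -> /=; split; first by rewrite od.
  rewrite def_y; lia.
by rewrite mulr_gt0 // divr_gt0 // ltr0n lt0n.
Qed.

Lemma oddcomps_complete fuel la : all odd la -> (sumn la <= fuel)%N ->
  la \in map fst (oddcomps fuel (sumn la)).
Proof.
elim: la fuel => [|d la IH] fuel /=; first by case: fuel.
case/andP=> od o_la; case: fuel => [|f] le_f; first by case: d od le_f.
have d_gt0 : (0 < d)%N by case: d od {le_f}.
rewrite /= -[_ == 0%N]negbK -lt0n addn_gt0 d_gt0 /=.
have /mapP[x x_in def_la] : la \in map fst (oddcomps f (sumn la)) by apply: IH; lia.
apply/mapP; exists (d :: x.1, 2 / (d + sumn la)%:R * x.2); last by rewrite -def_la.
apply/flatten_mapP; exists d; first by rewrite mem_filter od mem_iota; lia.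
by apply/mapP; exists x; rewrite // addKn.
Qed.

(** * Power sum expansions of products of rows and of hooks *)

Section Expansion.
Variables (R : comAlgType rat) (x : nat -> R) (N : nat).

Definition pprod (la : seq nat) : R := \prod_(d <- la) psum x N d.

(** In [newton2] the first part d is taken from either factor, which matches the two terms of 1 +
    u^d. *)
Lemma qrow2_pprod fuel i m : (i + m <= fuel)%N ->
  qrow x N i * qrow x N m =
    \sum_(y <- oddcomps fuel (i + m)) (y.2 * cprod y.1 i) *: pprod y.1.
Proof.
elim: fuel i m => [|f IH] i m le_f.
  have [-> ->] : i = 0%N /\ m = 0%N by lia.
  by rewrite !qrow0 big_seq1 /pprod big_nil mulr1 mul1r scale1r.
rewrite /=; case: eqP => [|/eqP nz_n].
  move/eqP; rewrite addn_eq0 => /andP[/eqP-> /eqP->].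
  by rewrite !qrow0 big_seq1 /pprod big_nil mulr1 mul1r scale1r.
set n := (i + m)%N in nz_n le_f *.
have nn0 : n%:R != 0 :> rat by rewrite pnatr_eq0.
apply: (can_inj (scalerK nn0)).
rewrite scaler_nat -[LHS]mulr_natl /n newton2 big_ltn_cond //= -/n add0r.
rewrite big_flatten big_map big_filter scaler_sumr [RHS]big_mkcond.
have -> : iota 1 n = index_iota 1 n.+1 by rewrite /index_iota subn1.
apply: eq_big_nat => d /andP[d_gt0 le_d]; case: ifP => // od.
rewrite big_map scaler_sumr.
have -> : (if (d <= i)%N then qrow x N (i - d) * qrow x N m else 0) =
   \sum_(y <- oddcomps f (n - d))
     (y.2 * (if (d <= i)%N then cprod y.1 (i - d) else 0)) *: pprod y.1.
  case: ifP => le_di; last by rewrite big1 // => y _; rewrite mulr0 scale0r.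
  rewrite IH; last by lia.
  by have -> : (i - d + m = n - d)%N by lia.
have -> : (if (d <= m)%N then qrow x N i * qrow x N (m - d) else 0) =
   \sum_(y <- oddcomps f (n - d)) (y.2 * cprod y.1 i) *: pprod y.1.
  case: ifP => le_dm.
    rewrite IH; last by lia.
    by have -> : (i + (m - d) = n - d)%N by lia.
  (* For d > m the remaining parts sum to n - d < i, so their product has no term u^i. *)
  rewrite big1_seq // => y /andP[_ /oddcompsP[_ sz_y _]].
  by rewrite cprod_gt ?mulr0 ?scale0r // sz_y; lia.
rewrite -big_split big_distrr; apply: eq_bigr => y _ /=.
rewrite {3}/pprod big_cons -/(pprod _) -scalerDl -mulrDr scalerA.
have -> : n%:R * (2 / n%:R * y.2 * (cprod y.1 i +
     (if (d <= i)%N then cprod y.1 (i - d) else 0))) =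
   2 * (y.2 * ((if (d <= i)%N then cprod y.1 (i - d) else 0) + cprod y.1 i)).
  by field.
rewrite -scalerAr [2 * (y.2 * _)]mulrC -[RHS]scalerA -mulrA.
by rewrite [X in _ *: X = _]mulr_natl scaler_nat.
Qed.

(** [hookS] and [cprodS] have the same shape, so each step in [j] is one subtraction. *)
Lemma hook_pprod j m :
  hook x N j m.+1 =
    \sum_(y <- oddcomps (j + m.+1) (j + m.+1)) (y.2 * calt y.1 j) *: pprod y.1.
Proof.
elim: j m => [|j IH] m.
  rewrite hook0 -[LHS]mul1r -(qrow0 x N) (@qrow2_pprod (0 + m.+1)%N) //.
  apply: eq_big_seq => y /oddcompsP[o_y _ _].
  by rewrite cprod0 // calt0.
have := hookS x N j m; rewrite IH addSnnS => /(canRL (addrK _)) ->.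
rewrite (@qrow2_pprod (j + m.+2)%N) addSnnS // -sumrB.
apply: eq_big_seq => y /oddcompsP[o_y _ _].
by rewrite cprodS // -scalerBl -mulrBr addrK.
Qed.
End Expansion.
End Coefficients.

(** * Counts as coefficients of multivariate polynomials *)

Section MonomialCoefficients.
Local Open Scope ring_scope.

(** Variables are indexed by all naturals in the sums above; the default 0 is never reached by
    indices below [N]. *)
Definition xvar N (i : nat) : {mpoly rat[N]} :=
  if insub i is Some j then 'X_(j : 'I_N) else 0.

Lemma xvarE N (i : 'I_N) : xvar N i = 'X_i.
Proof. by rewrite /xvar valK. Qed.

Lemma psum_xvar N d : psum (xvar N) N d = \sum_(i < N) 'X_i ^+ d.
Proof. by rewrite /psum big_mkord; apply: eq_bigr => i _; rewrite xvarE. Qed.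

Definition mexp N (a : 'I_N -> nat) : 'X_{1..N} := [multinom a i | i < N].

(** Expanding the product chooses one variable for each part, which is a function counted by
    [pcoef]. *)
Lemma pcoefE N la (a : 'I_N -> nat) :
  (pcoef la a)%:R = (pprod (xvar N) N la)@_(mexp a).
Proof.
rewrite /pprod (big_nth 0%N) big_mkord.
under eq_bigr do rewrite psum_xvar.
rewrite bigA_distr_bigA raddf_sum /pcoef -sum1_card big_mkcond natr_sum /=.
apply: eq_bigr => f _; rewrite inE.
rewrite mprodXnE mcoeffX; congr (_%:R).
have -> : [forall j, (\sum_(i | f i == j) nth 0 la i)%N == a j] =
    ((\sum_(i < size la) U_(f i) *+ nth 0%N la i)%MM == mexp a).
  apply/forallP/eqP => [eq_a | eq_m j].
    apply/mnmP => j; rewrite mnm_sumE mnmE -(eqP (eq_a j)) [RHS]big_mkcond.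
    by apply: eq_bigr => i _; rewrite mulmnE mnm1E; case: eqP; rewrite ?muln1 ?mul1n ?mul0n.
  have := congr1 (fun u : 'X_{1..N} => u j) eq_m; rewrite mnm_sumE mnmE => <-.
  rewrite big_mkcond; apply/eqP.
  by apply: eq_bigr => i _; rewrite mulmnE mnm1E; case: eqP; rewrite ?muln1 ?mul1n ?mul0n.
by case: ifP.
Qed.

Definition word B N (T : filling B N) : seq nat :=
  [seq val (T i) | i <- enum 'I_(size B)].

Lemma half_ord_lt N (i : 'I_(2 * N)) : (i./2 < N)%N.
Proof. have := ltn_ord i; lia. Qed.

Lemma rcoefE B N (P : pred (seq nat)) (a : 'I_N -> nat) :
    (forall T : filling B N, valid_filling T = P (word T)) ->
  (rcoef B a)%:R =
  (wsum N.*2 (size B) (fun w => (P w)%:R * wt (xvar N) w))@_(mexp a).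
Proof.
move=> validE; rewrite -mul2n wsum_ffun raddf_sum /rcoef -sum1_card.
rewrite big_mkcond natr_sum /=; apply: eq_bigr => T _; rewrite inE validE.
rewrite -/(word T); case: (P _); last by rewrite mul0r mcoeff0.
have -> : wt (xvar N) (word T) =
    'X_[(\sum_i U_(Ordinal (half_ord_lt (T i))))%MM].
  rewrite /wt /word big_map big_enum -mprodXE.
  by apply: eq_bigr => i _; rewrite -xvarE.
rewrite mul1r mcoeffX /=; congr (_%:R).
have -> : [forall j, content T j == a j] =
    ((\sum_i U_(Ordinal (half_ord_lt (T i))))%MM == mexp a).
  have cE j : content T j = (\sum_i U_(Ordinal (half_ord_lt (T i))))%MM j.
    rewrite mnm_sumE /content -sum1_card big_mkcond.
    by apply: eq_bigr => i _; rewrite inE mnm1E -val_eqE /=; case: ifP.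
  apply/forallP/eqP => [eq_a | eq_m j]; last by rewrite cE eq_m mnmE.
  by apply/mnmP => j; rewrite -cE mnmE; apply/eqP.
by case: ifP.
Qed.

End MonomialCoefficients.

(** * Fillings of the hook ribbon as words *)

Lemma ribbon_boxes_hook j m : ribbon_boxes (rcons (nseq j 1) m.+1) =
  [seq (i, m) | i <- iota 0 j] ++ [seq (j, c) | c <- iota 0 m.+1].
Proof.
rewrite /ribbon_boxes size_rcons size_nseq -(addn1 j) iotaD map_cat flatten_cat.
congr (_ ++ _); last first.
  rewrite /= cats0 nth_rcons size_nseq add0n ltnn eqxx drop_oversize //.
  by rewrite size_rcons size_nseq.
rewrite -[RHS]flatten_map1; congr flatten; apply/eq_in_map => i.
rewrite mem_iota /= add0n => lt_ij.
rewrite nth_rcons size_nseq lt_ij nth_nseq lt_ij /= drop_rcons ?size_nseq //.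
by rewrite map_rcons sumn_rcons drop_nseq map_nseq sumn_nseq mul0n addn0.
Qed.

Lemma nth_ribbon_hook j m i : i < (j + m).+1 ->
  nth (0, 0) (ribbon_boxes (rcons (nseq j 1) m.+1)) i =
    if i < j then (i, m) else (j, i - j).
Proof.
move=> lt_i; rewrite ribbon_boxes_hook nth_cat size_map size_iota.
case: ltnP => [lt_ij|le_ji].
  by rewrite (nth_map 0) ?size_iota // nth_iota // add0n.
by rewrite (nth_map 0) ?size_iota ?nth_iota ?add0n //; lia.
Qed.

Lemma size_ribbon_hook j m :
  size (ribbon_boxes (rcons (nseq j 1) m.+1)) = (j + m).+1.
Proof. by rewrite ribbon_boxes_hook size_cat !size_map !size_iota addnS. Qed.

(** Validity compares boxes by position, so the word condition is put in that form. Position [j + m]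
    is the corner, the only row box below the column. *)
Lemma hookwordP j m w : size w = (j + m).+1 ->
  reflect (forall a b, a < b -> b < (j + m).+1 ->
     (j <= a -> step odd (nth 0 w a) (nth 0 w b)) /\
     (a < j -> b < j \/ b = j + m -> step (predC odd) (nth 0 w a) (nth 0 w b)))
   (hookword j w).
Proof.
move=> sz_w; have sz_t : size (take j w) = j by rewrite size_takel // sz_w; lia.
have nth_t a : a <= j ->
    nth 0 (rcons (take j w) (last 0 w)) a = nth 0 w (if a < j then a else j + m).
  move=> le_aj; rewrite nth_rcons sz_t; case: ltnP => lt_aj; first by rewrite nth_take.
  have -> : a == j by lia.
  by rewrite -nth_last sz_w.
apply: (iffP andP) => [[/(pairwiseP 0) Hc /(pairwiseP 0) Hr] a b lt_ab lt_b | H].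
  split=> [le_ja | lt_aj b_ok].
    have := Hr (a - j) (b - j); rewrite !nth_drop !inE size_drop sz_w /=.
    by rewrite !subnKC //; [apply; lia | lia].
  have [lt_bj|le_jb] := ltnP b j.
    have := Hc a b; rewrite !inE size_rcons sz_t /= (nth_t a (ltnW lt_aj)).
    rewrite (nth_t b (ltnW lt_bj)) lt_aj lt_bj.
    by apply; lia.
  have -> : b = j + m by lia.
  have := Hc a j; rewrite !inE size_rcons sz_t /= (nth_t a (ltnW lt_aj)).
  rewrite (nth_t j (leqnn j)) lt_aj ltnn.
  by apply; lia.
split; apply/(pairwiseP 0) => a b; rewrite !inE.
  rewrite size_rcons sz_t => lt_a lt_b lt_ab; rewrite !nth_t //; try lia.
  have lt_aj : a < j by lia.
  rewrite lt_aj; case: ltnP => lt_bj.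
    by have [_ ->] := H a b lt_ab ltac:(lia); auto.
  by have [_ ->] := H a (j + m) ltac:(lia) ltac:(lia); auto.
rewrite size_drop sz_w => lt_a lt_b lt_ab; rewrite !nth_drop.
by have [-> //] := H (j + a) (j + b) ltac:(lia) ltac:(lia); lia.
Qed.

(** Weak increase and the rule for equal letters combine into [step odd] in rows and
    [step (predC odd)] in columns. *)
Lemma valid_hook j m N (T : filling (ribbon_boxes (rcons (nseq j 1) m.+1)) N) :
  valid_filling T = hookword j (word T).
Proof.
have sz := size_ribbon_hook j m.
have sz_w : size (word T) = (j + m).+1 by rewrite size_map size_enum_ord.
have nth_w (i : 'I_(size (ribbon_boxes (rcons (nseq j 1) m.+1)))) :
    nth 0 (word T) i = T i.
  by rewrite (nth_map i) ?size_enum_ord // nth_ord_enum.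
apply/idP/(hookwordP sz_w) => [V a b lt_ab lt_b | H].
  have lt_a : a < size (ribbon_boxes (rcons (nseq j 1) m.+1)) by rewrite sz; lia.
  have lt_b' : b < size (ribbon_boxes (rcons (nseq j 1) m.+1)) by rewrite sz.
  have := nth_w (Ordinal lt_a); have := nth_w (Ordinal lt_b') => /= -> ->.
  have := forallP (forallP V (Ordinal lt_a)) (Ordinal lt_b').
  rewrite /= !nth_ribbon_hook -?sz // -val_eqE /= /step /=.
  case: (ltnP a j); case: (ltnP b j) => /=; lia.
apply/forallP => i; apply/forallP => i'.
have lt_n (l : 'I_(size (ribbon_boxes (rcons (nseq j 1) m.+1)))) : l < (j + m).+1.
  by rewrite -sz.
have lt_i := lt_n i; have lt_i' := lt_n i'.
rewrite !nth_ribbon_hook // -val_eqE /=.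
have := H i i'; have := H i' i; rewrite !nth_w /step /=.
case: (ltnP i j); case: (ltnP i' j) => /=; lia.
Qed.

(** * Triangularity and independence of power sums *)

Definition part_exp n (la : seq nat) (j : 'I_n) : nat := nth 0 la j.

Lemma size_partition n la : is_partition n la -> size la <= n.
Proof.
case/and3P=> _ pos_la /eqP<-; elim: la pos_la => //= d la IH /andP[d_gt0 /IH]; lia.
Qed.

Lemma partition_perm_eq n la mu :
  is_partition n la -> is_partition n mu -> perm_eq la mu -> la = mu.
Proof.
case/and3P=> srt_la _ _ /and3P[srt_mu _ _]; apply: (@sorted_eq _ geq) => //.
  by move=> b a c /= ab bc; apply: leq_trans bc ab.
by move=> a b /= /andP[ab ba]; apply/eqP; rewrite eqn_leq ba ab.
Qed.

(** Each part of [la] is a sum of parts of [mu], so [mu] is at least as long; equal lengths make f a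
    bijection and [mu] a rearrangement of [la]. *)
Lemma pcoef_refine n la mu : is_partition n la -> is_partition n mu ->
  pcoef mu (@part_exp n la) != 0 -> mu != la -> size la < size mu.
Proof.
move=> p_la p_mu; rewrite -lt0n card_gt0 => /set0Pn[f]; rewrite inE => /forallP fP.
apply: contraNT; rewrite -leqNgt => le_sz; apply/eqP.
apply: (partition_perm_eq p_mu p_la).
pose s2 := [seq val (f i) | i <- enum 'I_(size mu)].
have sz2 : size s2 = size mu by rewrite size_map size_enum_ord.
(* A position missed by f would carry an empty sum, but the parts of [la] are positive. *)
have sub : {subset iota 0 (size la) <= s2}.
  move=> l; rewrite mem_iota /= add0n => lt_l.
  have lt_ln := leq_trans lt_l (size_partition p_la).
  have /negP nz : nth 0 la l != 0.
    by case/and3P: p_la => _ /allP/(_ (nth 0 la l) (mem_nth 0 lt_l)); rewrite lt0n.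
  apply: contraT => l_notin; case: nz; have := fP (Ordinal lt_ln).
  rewrite /part_exp /= big_pred0 1?eq_sym // => i.
  apply/eqP => fi; case/negP: l_notin; apply/mapP.
  by exists i; rewrite ?mem_enum // fi.
have perm_s2 : perm_eq (iota 0 (size la)) s2.
  have le_s2 : size s2 <= size (iota 0 (size la)) by rewrite sz2 size_iota.
  have [_ eq_s2] := uniq_min_size (iota_uniq 0 _) sub le_s2.
  by apply: uniq_perm => //; rewrite ?iota_uniq // (leq_size_uniq (iota_uniq 0 _) sub).
have inj_f : injective f.
  have inj_vf : injective (fun i => val (f i)).
    by apply/injectiveP; rewrite /injectiveb /dinjectiveb -(perm_uniq perm_s2) iota_uniq.
  by move=> i l eq_f; apply: inj_vf; rewrite eq_f.
have -> : mu = map (nth 0 la) s2.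
  apply: (@eq_from_nth _ 0) => [|i lt_i]; first by rewrite size_map sz2.
  rewrite (nth_map 0) ?sz2 // (nth_map (Ordinal lt_i)) ?size_enum_ord //.
  rewrite (_ : nth _ _ i = Ordinal lt_i); last by apply: val_inj; rewrite /= nth_enum_ord.
  have /eqP := fP (f (Ordinal lt_i)); rewrite /part_exp => <-.
  by rewrite (big_pred1 (Ordinal lt_i)) // => l /=; rewrite (inj_eq inj_f).
rewrite perm_sym -{1}(mkseq_nth 0 la); exact: perm_map.
Qed.

Lemma pcoef_self n la : is_partition n la -> pcoef la (@part_exp n la) != 0.
Proof.
move=> p_la; have le_n := size_partition p_la; rewrite -lt0n card_gt0.
apply/set0Pn; exists [ffun i => widen_ord le_n i]; rewrite inE; apply/forallP => l.
rewrite /part_exp; apply/eqP; have [lt_l | ge_l] := ltnP l (size la).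
  rewrite (big_pred1 (Ordinal lt_l)) // => i /=.
  by rewrite ffunE -!val_eqE.
rewrite nth_default // big_pred0 // => i; rewrite ffunE -val_eqE /=.
by have := ltn_ord i; lia.
Qed.

Section Positivity.
Local Open Scope ring_scope.

(** A list may repeat a partition, so only the total coefficient of each one is meaningful. *)
Lemma sum_grouped (d : seq (seq nat * rat)) (P : pred (seq nat)) g :
    (forall mu, mu \in map fst d -> P mu -> g mu != 0 -> \sum_(x <- d | x.1 == mu) x.2 = 0) ->
  \sum_(x <- d | P x.1) x.2 * g x.1 = 0.
Proof.
move=> d0.
transitivity (\sum_(x <- d) \sum_(mu <- undup (map fst d) | P mu)
                (if x.1 == mu then x.2 else 0) * g mu).
  rewrite big_mkcond; apply: eq_big_seq => x x_d.
  rewrite big_mkcond (bigD1_seq x.1) ?undup_uniq ?mem_undup ?map_f //= eqxx.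
  rewrite big1 ?addr0 // => mu; rewrite eq_sym => /negPf->.
  by rewrite mul0r if_same.
rewrite exchange_big big_seq_cond big1 // => mu /andP[].
rewrite mem_undup => mu_d Pmu.
rewrite -big_distrl -big_mkcond /=.
by have [->|nz_g] := eqVneq (g mu) 0; rewrite ?mulr0 // d0 ?mul0r.
Qed.

(** Induction from the longest partitions down: at the monomial of [la] only [la] and longer
    partitions contribute, and the longer ones already have total 0. *)
Lemma pcoef_indep n (d : seq (seq nat * rat)) :
    all (fun x => is_partition n x.1) d ->
    (forall a : 'I_n -> nat, \sum_(x <- d) x.2 * (pcoef x.1 a)%:R = 0) ->
  forall la, is_partition n la -> \sum_(x <- d | x.1 == la) x.2 = 0.
Proof.
move=> /allP p_d rel0 la; have [e] := ubnP (n - size la)%N.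
elim: e la => // e IH la lt_e p_la.
have := rel0 (@part_exp n la).
rewrite (bigID (fun x => x.1 == la)) /=.
rewrite [X in _ + X = 0](@sum_grouped d (fun mu => mu != la)
  (fun mu => (pcoef mu (@part_exp n la))%:R)) ?addr0; last first.
  move=> mu /mapP[x x_d ->] neq_la; rewrite pnatr_eq0 => nz.
  have p_mu := p_d _ x_d; apply: IH => //.
  have := pcoef_refine p_la p_mu nz neq_la; have := size_partition p_mu; lia.
rewrite (eq_bigr (fun x => x.2 * (pcoef la (@part_exp n la))%:R)); last first.
  by move=> x /eqP->.
rewrite -big_distrl => /eqP; rewrite mulf_eq0 pnatr_eq0.
by rewrite (negPf (pcoef_self p_la)) orbF => /eqP.
Qed.

Lemma is_partition_sort n la : all odd la -> sumn la = n -> is_partition n (sort geq la).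
Proof.
move=> o_la def_n; apply/and3P; split.
- by apply: sort_sorted => a b; apply: leq_total.
- by rewrite all_sort; apply: sub_all o_la => -[].
- by rewrite (perm_sumn (permEl (perm_sort _ _))) def_n.
Qed.

(** * The positivity criterion *)

Lemma pcoef_sort N la (a : 'I_N -> nat) :
  (pcoef (sort geq la) a)%:R = (pprod (xvar N) N la)@_(mexp a).
Proof.
by rewrite pcoefE /pprod (perm_big _ (permEl (perm_sort _ _))).
Qed.

Definition hook_pexpansion j m : seq (seq nat * rat) :=
  [seq (sort geq y.1, y.2 * calt y.1 j) | y <- oddcomps (j + m.+1) (j + m.+1)].

Lemma hook_pexpansionP j m N (a : 'I_N -> nat) :
  (rcoef (ribbon_boxes (rcons (nseq j 1%N) m.+1)) a)%:R =
    \sum_(x <- hook_pexpansion j m) x.2 * (pcoef x.1 a)%:R.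
Proof.
rewrite (@rcoefE _ _ (hookword j)); last exact: valid_hook.
rewrite size_ribbon_hook -addnS -/(hook (xvar N) N j m.+1) hook_pprod raddf_sum.
rewrite big_map; apply: eq_bigr => y _ /=.
by rewrite mcoeffZ pcoef_sort.
Qed.

Lemma p_positive_hookP j m :
  p_positive (rcons (nseq j 1%N) m.+1) <->
  forall la, all odd la -> sumn la = (j + m.+1)%N -> 0 <= calt la j.
Proof.
rewrite /p_positive size_ribbon_hook -addnS; split=> [[s [s_ok sP]] la o_la def_n | ge0].
  rewrite leNgt; apply/negP => lt0.
  pose t := hook_pexpansion j m; pose mu := sort geq la.
  (* The difference of the two expansions has total 0 at [mu]. If [calt la j] is negative, its terms
     at [mu] are all nonnegative and at least one is positive. *)
  pose d := s ++ [seq (y.1, - y.2) | y <- t].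
  have p_mu : is_partition (j + m.+1) mu by apply: is_partition_sort.
  have p_d : all (fun x => is_partition (j + m.+1) x.1) d.
    rewrite all_cat (sub_all _ s_ok) => [|x /andP[] //].
    apply/allP => _ /mapP[_ /mapP[y /oddcompsP[o_y sum_y _] ->] ->] /=.
    exact: is_partition_sort.
  have rel (a : 'I_(j + m.+1) -> nat) : \sum_(x <- d) x.2 * (pcoef x.1 a)%:R = 0.
    rewrite big_cat big_map /= -sP hook_pexpansionP -big_split big1 // => y _.
    by rewrite /= mulNr subrr.
  have := pcoef_indep p_d rel p_mu; rewrite big_cat !big_map /= => /eqP.
  have s_ge0 : 0 <= \sum_(x <- s | x.1 == mu) x.2.
    by rewrite big_seq_cond sumr_ge0 // => x /andP[/(allP s_ok)/andP[]].
  have term_gt0 y : (y \in oddcomps (j + m.+1) (j + m.+1)) && (sort geq y.1 == mu) ->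
      0 < - (y.2 * calt y.1 j).
    case/andP=> /oddcompsP[_ _ y_gt0] /eqP eq_mu.
    rewrite (@calt_perm y.1 la); first by rewrite -mulrN mulr_gt0 // oppr_gt0.
    by rewrite -(perm_sort geq) eq_mu perm_sort.
  rewrite paddr_eq0 //; last by rewrite big_seq_cond sumr_ge0 // => y /term_gt0/ltW.
  case/andP=> _; rewrite big_seq_cond psumr_eq0 => [|y /term_gt0/ltW] //.
  have /mapP[y y_in def_la] : la \in map fst (oddcomps (j + m.+1) (j + m.+1)).
    by rewrite -def_n; apply: oddcomps_complete; rewrite // def_n.
  move/allP/(_ y y_in).
  have y_ok : (y \in oddcomps (j + m.+1) (j + m.+1)) && (sort geq y.1 == mu).
    by rewrite y_in -def_la eqxx.
  by rewrite y_ok /= gt_eqF ?term_gt0.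
exists (hook_pexpansion j m); split=> [|a]; last exact: hook_pexpansionP.
apply/allP => _ /mapP[y /oddcompsP[o_y sum_y y_gt0] ->] /=.
by rewrite is_partition_sort //= mulr_ge0 ?ge0 // ltW.
Qed.

(** * Parts with a negative coefficient *)

Lemma calt_one d i : odd d -> calt [:: d] i = if (i < d)%N then (-1) ^+ odd i else 0.
Proof.
move=> od; case: ltnP => [lt_i | le_d]; last by rewrite calt_ge //= ?od ?addn0.
by rewrite /= leqNgt lt_i addr0 signr_odd.
Qed.

Lemma calt_cons_lt d la i : (i < d)%N -> calt (d :: la) i = calt la i.
Proof. by move=> lt_i; rewrite /= leqNgt lt_i addr0. Qed.

Lemma calt_cons_ge d la i : (d <= i)%N -> calt (d :: la) i = calt la i + calt la (i - d).
Proof. by move=> le_d; rewrite /= le_d. Qed.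

Definition negative_hook n j : Prop :=
  exists la, [/\ all odd la, sumn la = n & calt la j < 0].

Lemma negative_hook_sym n i j : (i + j).+1 = n -> negative_hook n i -> negative_hook n j.
Proof.
move=> def_n [la [o_la sum_la neg]]; exists la; split=> //.
rewrite -(@calt_sym la i j) // ?sum_la //.
by case: la sum_la {o_la neg} => //= n0; rewrite -n0 in def_n.
Qed.

Lemma negative_odd_odd n j : odd n -> odd j -> (j < n)%N -> negative_hook n j.
Proof.
move=> on oj lt_j; exists [:: n]; rewrite /= on addn0; split=> //.
by rewrite -/(calt [:: n] j) calt_one // lt_j oj.
Qed.

Lemma negative_odd_even n j : odd n -> ~~ odd j -> (4 <= j)%N -> (j.*2 < n)%N ->
  negative_hook n j.
Proof.
move=> on ej j4 lt_j; pose c := (n - j.*2 + 2)%N.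
have oc : odd c by rewrite /c; lia.
have oj1 : odd j.-1 by lia.
exists [:: j.-1; j.-1; c]; split; first by rewrite /= oj1 oc.
  by rewrite /= /c; lia.
(* With f the coefficients for [[:: c]], the value is f_j + 2 f_1, where f_1 = -1 and f_j is 0 or
   1. *)
have j1 : (j - j.-1 = 1)%N by lia.
rewrite calt_cons_ge ?leq_pred // j1 calt_cons_ge ?leq_pred // j1.
rewrite (@calt_cons_lt j.-1); last by lia.
rewrite !calt_one // (_ : (1 < c)%N); last by rewrite /c; lia.
by case: ifP => _; rewrite ?(negPf ej) /=; lra.
Qed.

Lemma negative_even_odd n j : ~~ odd n -> odd j -> (j.*2 + 4 <= n)%N -> negative_hook n j.
Proof.
move=> en oj le_n; exists [:: j.+2; (n - j.+2)%N].
have oc : odd (n - j.+2) by lia.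
split; first by rewrite /= oc negbK oj.
  by rewrite /=; lia.
(* Both parts exceed [j], so the coefficient is that of 1 / (1 + u). *)
rewrite calt_cons_lt // calt_one // oj (_ : (j < n - j.+2)%N) //; lia.
Qed.

Lemma negative_even_even n j : ~~ odd n -> ~~ odd j -> (4 <= j)%N -> (j.*2 + 4 <= n)%N ->
  negative_hook n j.
Proof.
move=> en ej j4 le_n; pose c := (n - j.*2 - 1)%N.
have oc : odd c by rewrite /c; lia.
have oj1 : odd j.-1 by lia.
exists [:: j.-1; j.-1; 3; c]%N; split; first by rewrite /= oj1 oc.
  by rewrite /= /c; lia.
(* With f the coefficients for [[:: 3; c]], the value is f_j + 2 f_1. Here f_1 = -1 and f_j is at
   most 0: for j < c the part 3 cancels the 1 at index j. *)
have j1 : (j - j.-1 = 1)%N by lia.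
rewrite calt_cons_ge ?leq_pred // j1 calt_cons_ge ?leq_pred // j1.
rewrite (@calt_cons_lt j.-1); last by lia.
rewrite (@calt_cons_lt 3 _ 1) // (@calt_cons_ge 3); last by lia.
rewrite !calt_one // (_ : (1 < c)%N); last by rewrite /c; lia.
rewrite (_ : odd (j - 3)); last by lia.
rewrite (negPf ej) /=; case: (ltnP j c) => lt_j; last by case: ifP => _; lra.
by rewrite ifT; [lra | lia].
Qed.

End Positivity.

Theorem mainTheorem12 (n k : nat) (hk : (0 < k)%N) (hkn : (k <= n)%N) :
  ((n <= 2)%N -> p_positive (tri n k)) /\
  ((3 <= n)%N -> odd n ->
     (p_positive (tri n k) <-> k \in [:: 1; 3; n - 2; n]%N)) /\
  ((4 <= n)%N -> ~~ odd n ->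
     (p_positive (tri n k) <->
        k \in [:: 1; 3; n./2; n./2 + 1; n - 2; n]%N)).
Proof.
have [j def_k] : exists j, k = j.+1 by exists k.-1; lia.
have [m def_n] : exists m, n = j + m.+1 by exists (n - k); lia.
have posP : p_positive (tri n k) <->
    forall la, all odd la -> sumn la = n -> (0 <= calt la j)%R.
  rewrite def_n -p_positive_hookP /tri def_k.
  by have -> : j + m.+1 - j.+1 + 1 = m.+1 by lia.
have nz la : sumn la = n -> la != [::] by case: la => //= n0; lia.
have pos0 : j = 0 -> p_positive (tri n k).
  by move=> j0; apply/posP => la o_la _; rewrite j0 calt0.
have pos_last : j.+1 = n -> p_positive (tri n k).
  move=> j_n; apply/posP => la o_la sum_la.
  by rewrite (@calt_sym la j 0) ?calt0 ?nz // sum_la addn0.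
have pos2 : j = 2 -> p_positive (tri n k).
  by move=> j2; apply/posP => la o_la _; rewrite j2 calt2_ge0.
have pos_n3 : j.+3 = n -> p_positive (tri n k).
  move=> j_n; apply/posP => la o_la sum_la.
  by rewrite (@calt_sym la j 2) ?calt2_ge0 ?nz // sum_la addn2.
have negP : negative_hook n j -> ~ p_positive (tri n k).
  move=> [la [o_la sum_la neg]] /posP/(_ la o_la sum_la) ge0.
  by rewrite ltNge ge0 in neg.
split; first by move=> n2; have [/pos0|/pos_last] : j = 0 \/ j.+1 = n by lia.
split=> [n3 on | n4 en].
  split=> [pos | ]; last first.
    rewrite !inE => k_in.
    by have [/pos0|[/pos2|[/pos_n3|/pos_last]]] :
      j = 0 \/ j = 2 \/ j.+3 = n \/ j.+1 = n by lia.
  apply: contraPT pos; rewrite !inE => k_out; apply: negP.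
  have [oj|ej] := boolP (odd j); first by apply: negative_odd_odd => //; lia.
  have [lt_j|ge_j] := ltnP j.*2 n; first by apply: negative_odd_even => //; lia.
  (* For n odd the reflection preserves the parity of [j]. *)
  apply: (@negative_hook_sym _ (n - j.+1)); first by lia.
  by apply: negative_odd_even => //; lia.
split=> [pos | ]; last first.
  rewrite !inE => k_in.
  have [?|[?|[?|[?|[j_mid|j_mid]]]]] : j = 0 \/ j = 2 \/ j.+3 = n \/ j.+1 = n \/
      n = j.+1.*2 \/ n = j.*2 by lia.
  1,2,3,4: by auto.
  - apply/posP => la o_la sum_la.
    by apply: calt_mid_ge0; rewrite ?nz // sum_la.
  - case: (posnP j) => [?|j_gt0]; first by auto.
    apply/posP => la o_la sum_la; rewrite (@calt_sym la j j.-1) ?nz //; last by lia.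
    by apply: calt_mid_ge0; rewrite ?nz // sum_la prednK.
apply: contraPT pos; rewrite !inE => k_out; apply: negP.
(* Excluding k = n/2 rules out j = n/2 - 1, which leaves 2j + 4 <= n in the lower half. Reflection
   now changes parity, so parity is tested again in the upper half. *)
have [lt_j|ge_j] := ltnP j n./2.
  have [oj|ej] := boolP (odd j); first by apply: negative_even_odd => //; lia.
  by apply: negative_even_even => //; lia.
apply: (@negative_hook_sym _ (n - j.+1)); first by lia.
have [oj|ej] := boolP (odd (n - j.+1)); first by apply: negative_even_odd => //; lia.
by apply: negative_even_even => //; lia.
Qed.
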